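(* Let $G$ be a countable discrete amenable group, $X=\mathbb{N}^G$, and let $\phi\colon X\to\mathbb{R}$ be a continuous potential. Then, for any nonempty finite alphabet $A\subseteq\mathbb{N}$, the limit $$p(A,\phi)=\lim_{F\to G}\frac{1}{|F|}\log Z_F(A,\phi)$$ exists and $$p(A,\phi)=\inf_{E\in\mathcal{F}(G)}\frac{1}{|E|}\log Z_E(A,\phi).$$
   Context: $\mathbb{N}$ is the set of non-negative integers with the discrete topology, and $X=\mathbb{N}^G$ carries the product topology; a potential is a function $X\to\mathbb{R}$. $\mathcal{F}(G)$ is the set of nonempty finite subsets of $G$. $G$ acts on $X$ by $(g\cdot x)(h)=x(hg)$. For $F\in\mathcal{F}(G)$, $\phi_F(x)=\sum_{g\in F}\phi(g\cdot x)$, and for $w\in\mathbb{N}^F$, $[w]=\{x\in X: x_F=w\}$, where $x_F$ is the restriction of $x$ to $F$. For nonempty finite $A\subseteq\mathbb{N}$, $Z_F(A,\phi)=\sum_{w\in A^F}\exp\left(\sup\phi_F([w]\cap A^G)\right)$. For $K,F\in\mathcal{F}(G)$ and $\delta>0$, $F$ is $(K,\delta)$-invariant if $|KF\,\triangle\,F|<\delta|F|$, where $KF=\{kf:k\in K,f\in F\}$; $G$ is amenable if for all $K\in\mathcal F(G)$, $\delta>0$ a $(K,\delta)$-invariant $F\in\mathcal F(G)$ exists. For $\varphi\colon\mathcal{F}(G)\to\mathbb{R}$ and $L\in\mathbb{R}$, $\lim_{F\to G}\varphi(F)=L$ means: for every $\epsilon>0$ there are $K\in\mathcal{F}(G)$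 and $\delta>0$ such that $|\varphi(F)-L|<\epsilon$ for every $(K,\delta)$-invariant $F\in\mathcal{F}(G)$. *)

(* Defs.v *)
From HB Require Import structures.
From mathcomp Require Import all_boot all_order all_algebra finmap.
From mathcomp Require Import all_classical all_reals all_analysis.
Set Implicit Arguments.
Unset Strict Implicit.
Unset Printing Implicit Defensive.

Import Order.TTheory GRing.Theory Num.Theory.
Import numFieldNormedType.Exports.

Local Open Scope classical_set_scope.
Local Open Scope ring_scope.

Section FinsetsOfGroup.
Variable G : groupType.
Implicit Types K F : {fset G}.

Definition fset_mulg K F : {fset G} :=
  [fset (k * f)%g | k in K, f in F]%fset.

Definition fset_symdiff K F : {fset G} :=
  ((K `\` F) `|` (F `\` K))%fset.

Definition invariant_fset (R : realType) K (delta : R) F : Prop :=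
  (#|` fset_symdiff (fset_mulg K F) F|)%:R < delta * (#|` F|)%:R.

Definition amenable (R : realType) : Prop :=
  forall K (delta : R), K != fset0 -> 0 < delta ->
    exists2 F, F != fset0 & invariant_fset K delta F.

Definition folner_cvg (R : realType) (f : {fset G} -> R) (L : R) : Prop :=
  forall eps : R, 0 < eps ->
    exists K (delta : R),
      [/\ K != fset0, 0 < delta
        & forall F, F != fset0 -> invariant_fset K delta F ->
            `|f F - L| < eps].

End FinsetsOfGroup.

Section Pressure.
Variables (G : groupType) (R : realType).

(* Functions G -> nat with the topology of pointwise convergence, i.e. the
   product topology; the topology of [nat] in the library is discrete. *)
Definition full_shift := {ptws G -> nat}.

Definition shift_act (g : G) (x : full_shift) : full_shift :=
  fun h => x (h * g)%g.

Definition birkhoff_sum (phi : full_shift -> R) (F : {fset G})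
    (x : full_shift) : R :=
  \sum_(g <- F) phi (shift_act g x).

Definition cylinder (F : {fset G}) (w : F -> nat) : set full_shift :=
  [set x | forall g : F, x (val g) = w g].

Definition subshift_on (A : {fset nat}) : set full_shift :=
  [set x | forall g : G, x g \in A].

(* When A is nonempty and phi is continuous, the supremum below is that of a
   nonempty bounded set of reals ([subshift_on A] is compact), so it is never
   the default value 0 of [sup]. *)
Definition partition_fun (A : {fset nat}) (phi : full_shift -> R)
    (F : {fset G}) : R :=
  \sum_(w : {ffun F -> A})
    expR (sup (birkhoff_sum phi F @`
                 (cylinder (fun g => val (w g)) `&` subshift_on A))).

Definition mean_log_partition (A : {fset nat}) (phi : full_shift -> R)
    (F : {fset G}) : R :=
  (#|` F|)%:R^-1 * ln (partition_fun A phi F).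

End Pressure.

(* Main.v *)
Require Import Defs.
From HB Require Import structures.
From mathcomp Require Import all_boot all_order all_algebra finmap.
From mathcomp Require Import all_classical all_reals all_analysis.
From mathcomp Require Import ring lra.
Import Order.TTheory GRing.Theory Num.Theory.
Import numFieldNormedType.Exports.

(* The normalised log-partition function q(F) = log Z_F - |F| log |A| is the
   logarithm of the average over w in A^F of exp (sup phi_F([w] cap A^G)).  If
   sets E_i cover every point of F exactly k times, then k phi_F is the sum of
   the phi_{E_i}, and Finner's inequality (an iterated Hoelder inequality)
   gives the Shearer-type bound k q(F) <= sum_i q(E_i).  Apply this to the sets
   Eg cap F, which cover F exactly |E| times: at most |F| of the translates Eg
   lie in F, and those contribute q(E) each, while for F almost invariant under
   E E^-1 only few of the others meet F.  Hence
   q(F)/|F| <= q(E)/|E| + o(1) for every fixed E, so the lower bound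
   inf_E q(E)/|E| is also the limit. *)

Set Implicit Arguments.
Unset Strict Implicit.
Unset Printing Implicit Defensive.

Local Open Scope classical_set_scope.
Local Open Scope ring_scope.

(** * Logarithms of exponential averages, and Hölder's inequality *)

Section LogMean.
Variable R : realType.

Definition logmean (S : finType) (u : S -> R) : R :=
  ln (#|S|%:R^-1 * \sum_s expR (u s)).

Lemma sum_expR_gt0 (S : finType) (s0 : S) (u : S -> R) : 0 < \sum_s expR (u s).
Proof.
rewrite (bigD1 s0) //= ltr_pwDl ?expR_gt0 //.
by apply: sumr_ge0 => ? _; exact: expR_ge0.
Qed.

Lemma expR_logmean (S : finType) (s0 : S) (u : S -> R) :
  expR (logmean u) = #|S|%:R^-1 * \sum_s expR (u s).
Proof.
apply: lnK; rewrite posrE mulr_gt0 ?invr_gt0 ?ltr0n ?(sum_expR_gt0 s0) //.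
by apply/card_gt0P; exists s0.
Qed.

Lemma logmean_cst (S : finType) (s0 : S) (c : R) : logmean (fun _ : S => c) = c.
Proof.
have S0 : (#|S|%:R : R) != 0 by rewrite pnatr_eq0 -lt0n; apply/card_gt0P; exists s0.
by rewrite /logmean sumr_const -[expR c *+ _]mulr_natl mulKf // expRK.
Qed.

Lemma ler_logmean (S : finType) (s0 : S) (u v : S -> R) :
  (forall s, u s <= v s) -> logmean u <= logmean v.
Proof.
move=> uv; rewrite -ler_expR !(expR_logmean s0) ler_wpM2l ?invr_ge0 ?ler0n //.
by apply: ler_sum => s _; rewrite ler_expR.
Qed.

(** Convexity: [expR] lies above its tangent at the mean [m], and the deviations from [m] sum to
    zero. *)
Lemma expR_mean (I : finType) (J : {set I}) (x : I -> R) :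
  (0 < #|J|)%N ->
  expR (#|J|%:R^-1 * \sum_(i in J) x i) <=
  #|J|%:R^-1 * \sum_(i in J) expR (x i).
Proof.
move=> J0; set m := _^-1 * _.
have J0' : (#|J|%:R : R) != 0 by rewrite pnatr_eq0 -lt0n.
have -> : expR m = #|J|%:R^-1 * \sum_(i in J) (expR m * (1 + (x i - m))).
  rewrite -mulr_sumr big_split /= sumrB !sumr_const -[m *+ _]mulr_natl.
  by rewrite /m mulVKf // subrr addr0 mulrCA mulVf // mulr1.
apply: ler_wpM2l; first by rewrite invr_ge0. apply: ler_sum => i _.
have -> : expR (x i) = expR m * expR (x i - m) by rewrite -expRD addrC subrK.
by rewrite ler_wpM2l ?expR_ge0 // expR_ge1Dx.
Qed.

(* The generalised Hoelder inequality for the functions [exp (u i)], of which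
   only the ones with index in [J] are not constant. *)
Lemma logmean_holder (S I : finType) (s0 : S) (J : {set I}) (u : I -> S -> R) :
  (0 < #|J|)%N ->
  (forall i, i \notin J -> forall s, u i s = u i s0) ->
  logmean (fun s => #|J|%:R^-1 * \sum_i u i s) <=
  #|J|%:R^-1 * \sum_i logmean (u i).
Proof.
move=> J0 uJ; have J0' : (#|J|%:R : R) != 0 by rewrite pnatr_eq0 -lt0n.
have S0 : (#|S|%:R : R) != 0 by rewrite pnatr_eq0 -lt0n; apply/card_gt0P; exists s0.
(* Subtracting the log-mean normalises each [expR (u i)] to average 1. It then suffices to apply
   [expR_mean] at each [s] and exchange the sums. *)
pose d i s := u i s - logmean (u i).
have dJ i s : i \notin J -> d i s = 0.
  move=> /uJ ui; rewrite /d (_ : u i = fun=> u i s0) ?logmean_cst ?subrr //.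
  by apply/funext => t; rewrite ui.
rewrite -ler_expR (expR_logmean s0).
under eq_bigr => s _.
  rewrite (_ : _ * _ = #|J|%:R^-1 * \sum_(i in J) d i s +
                       #|J|%:R^-1 * \sum_i logmean (u i)).
    rewrite expRD; over.
  rewrite -mulrDr; congr (_ * _).
  have -> : \sum_(i in J) d i s = \sum_i d i s.
    by rewrite big_mkcond; apply: eq_bigr => i _; case: ifPn => // /dJ.
  by rewrite sumrB subrK.
rewrite -mulr_suml mulrA ger_pMl ?expR_gt0 // ler_pdivrMl ?lt0r ?S0 ?ler0n // mulr1.
apply: le_trans (ler_sum _ (fun s _ => expR_mean (d^~ s) J0)) _.
rewrite -mulr_sumr exchange_big /= ler_pdivrMl ?ltr0n // -natrM.
rewrite [leRHS](_ : _ = \sum_(i in J) (#|S|%:R : R)); last first.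
  by rewrite sumr_const natrM mulr_natl.
apply: ler_sum => i _.
under eq_bigr do rewrite /d expRB.
rewrite -mulr_suml (expR_logmean s0) invfM invrK mulrCA divff ?mulr1 //.
by rewrite gt_eqF // (sum_expR_gt0 s0).
Qed.

End LogMean.

(** * Finner's inequality on finite product spaces *)

Section Finner.
Variables (R : realType) (T S : finType) (s0 : S).
Implicit Types (u : {ffun T -> S} -> R) (w : {ffun T -> S}).

Definition update w t s : {ffun T -> S} := [ffun t' => if t' == t then s else w t'].

Definition coord_indep t u := forall w s, u (update w t s) = u w.

(** Integrates out coordinate [t] on the logarithmic scale. The result is still a function on the
    full product, so the operation can be iterated. *)
Definition logmean_at t u : {ffun T -> S} -> R :=
  fun w => logmean (fun s => u (update w t s)).

Lemma update_same w t s s' : update (update w t s) t s' = update w t s'.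
Proof. by apply/ffunP => x; rewrite !ffunE; case: eqP. Qed.

Lemma update_comm w t t' s s' : t != t' ->
  update (update w t s) t' s' = update (update w t' s') t s.
Proof.
move=> tt'; apply/ffunP => x; rewrite !ffunE; case: eqP => // ->.
by rewrite eq_sym (negPf tt').
Qed.

Lemma update_id w t : update w t (w t) = w.
Proof. by apply/ffunP => x; rewrite ffunE; case: eqP => // ->. Qed.

Lemma coord_indep_logmean_at t u : coord_indep t (logmean_at t u).
Proof.
move=> w s; rewrite /logmean_at; congr logmean.
by apply/funext => s'; rewrite update_same.
Qed.

Lemma coord_indep_logmean_at_stable t t' u :
  coord_indep t u -> coord_indep t (logmean_at t' u).
Proof.
have [<- _|tt'] := eqVneq t t'; first exact: coord_indep_logmean_at.
move=> ut w s; rewrite /logmean_at; congr logmean.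
by apply/funext => s'; rewrite update_comm // ut.
Qed.

Lemma ler_logmean_at t u v :
  (forall w, u w <= v w) -> forall w, logmean_at t u w <= logmean_at t v w.
Proof. by move=> uv w; apply: ler_logmean. Qed.

Lemma logmean_logmean_at t u : logmean (logmean_at t u) = logmean u.
Proof.
rewrite /logmean; congr (ln (_ * _)).
under eq_bigr do rewrite (expR_logmean s0).
have S0 : (#|S|%:R : R) != 0 by rewrite pnatr_eq0 -lt0n; apply/card_gt0P; exists s0.
rewrite -mulr_sumr; apply: (mulfI S0); rewrite mulVKf // pair_big /=.
(* Swapping coordinate [t] with the extra letter turns the double sum into [#|S|] copies of the sum
   over [w]. *)
pose h (p : {ffun T -> S} * S) := (update p.1 t p.2, p.1 t).
have hK : involutive h.
  by case=> w s; rewrite /h /= update_same update_id ffunE eqxx.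
rewrite (reindex_inj (inv_inj hK)) /=.
under eq_bigr => p _ do rewrite update_same update_id.
rewrite -(pair_big predT predT (fun w (_ : S) => expR (u w))) /=.
by under eq_bigr do rewrite sumr_const -[_ *+ _]mulr_natl; rewrite mulr_sumr.
Qed.

Lemma coord_indep_all u :
  (forall t, coord_indep t u) -> forall w w', u w = u w'.
Proof.
move=> ui w w'; pose v (s : seq T) := foldr (fun t x => update x t (w' t)) w s.
have -> : w' = v (enum T).
  apply/ffunP => t; have : t \in enum T by rewrite mem_enum.
  elim: (enum T) => //= a s IH; rewrite inE ffunE.
  by case: eqP => [->//|_ /IH].
by elim: (enum T) => //= t s ->; rewrite ui.
Qed.

(* Finner's inequality, for the functions [exp (u i)] under the uniform
   probability: integrate out one coordinate at a time with Hoelder. *)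
Lemma logmean_finner (I : finType) (k : nat) (J : T -> {set I})
    (u : {ffun T -> S} -> R) (v : I -> {ffun T -> S} -> R) :
  (0 < k)%N -> (forall t, #|J t| = k) ->
  (forall t i, i \notin J t -> coord_indep t (v i)) ->
  (forall w, u w <= k%:R^-1 * \sum_i v i w) ->
  logmean u <= k%:R^-1 * \sum_i logmean (v i).
Proof.
move=> k0 Jk vJ uv.
pose L (s : seq T) f := foldr logmean_at f s.
have Lmean s f : logmean (L s f) = logmean f.
  by elim: s => //= t s IH; rewrite logmean_logmean_at.
have Lindep s f t : coord_indep t f -> coord_indep t (L s f).
  by elim: s => //= t' s IH /IH; exact: coord_indep_logmean_at_stable.
have Lindep' f t : coord_indep t (L (enum T) f).
  have : t \in enum T by rewrite mem_enum.
  elim: (enum T) => //= t' s IH; rewrite inE.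
  have [-> _|_ /IH] := eqVneq t t'; first exact: coord_indep_logmean_at.
  exact: coord_indep_logmean_at_stable.
(* Each new coordinate [t] costs one use of Hölder with index set [J t]: by [Lindep], earlier
   integrations keep the other functions independent of [t]. *)
have Lle s w : L s u w <= k%:R^-1 * \sum_i L s (v i) w.
  elim: s w => //= t s IH w.
  apply: le_trans (ler_logmean_at t IH w) _.
  rewrite /logmean_at -(Jk t).
  apply: (@logmean_holder _ _ _ s0 _ (fun i s' => L s (v i) (update w t s'))).
    by rewrite Jk.
  by move=> i iJ s'; rewrite !(Lindep s (v i) t (vJ _ _ iJ)).
pose w0 : {ffun T -> S} := [ffun=> s0].
(* Once every coordinate is integrated out, the function is constant and equals its log-mean. *)
have LE f : logmean f = L (enum T) f w0.
  rewrite -(Lmean (enum T)) -[RHS](logmean_cst w0); congr logmean.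
  by apply/funext => w; apply: coord_indep_all.
by rewrite LE; under eq_bigr do rewrite LE.
Qed.

End Finner.

(** * Uniform averages under restriction of coordinates *)

(** All fibres of restriction along [j] have the same size, so the uniform distribution is sent to
    the uniform one. *)
Lemma logmean_comp_inj (R : realType) (S T A : finType) (a0 : A) (j : S -> T)
    (f : {ffun S -> A} -> R) : injective j ->
  logmean (fun w : {ffun T -> A} => f [ffun s => w (j s)]) = logmean f.
Proof.
move=> jI; rewrite /logmean; congr ln.
have ST : (#|S| <= #|T|)%N by rewrite -(card_codom jI) max_card.
pose r (w : {ffun T -> A}) : {ffun S -> A} := [ffun s => w (j s)].
have fiber v : #|[pred w | r w == v]| = (#|A| ^ (#|T| - #|S|))%N.
  (* The letters allowed at [t] in the fibre over [v]: a single one on the image of [j], all of [A]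
     elsewhere. *)
  pose P t : pred A := [pred a | [forall s, (j s == t) ==> (a == v s)]].
  rewrite (eq_card (B := family P)); last first.
    move=> w; rewrite [LHS]inE; apply/eqP/familyP => [rw t|wP].
      rewrite inE -rw; apply/forallP => s.
      by apply/implyP => /eqP <-; rewrite ffunE.
    apply/ffunP => s; rewrite ffunE; move/(_ (j s)): wP; rewrite inE.
    by move=> /forallP /(_ s); rewrite eqxx => /eqP.
  rewrite card_family foldrE big_map big_enum /=.
  rewrite (bigID (mem (codom j))) /= big1 ?mul1n; last first.
    move=> t /codomP[s ->]; rewrite -(card1 (v s)); apply: eq_card => a; rewrite !inE.
    apply/forallP/eqP => [/(_ s)|-> s']; first by rewrite eqxx => /eqP.
    by apply/implyP => /eqP /jI ->.
  rewrite (eq_bigr (fun=> #|A|)); last first.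
    move=> t tj; apply: eq_card => a; rewrite !inE; apply/forallP => s.
    by apply/implyP => /eqP jt; rewrite -jt codom_f in tj.
  rewrite prod_nat_const; congr (_ ^ _)%N.
  by rewrite -(card_codom jI) -(cardC (mem (codom j))) addKn.
have A0 : (#|A|%:R : R) != 0.
  by rewrite pnatr_eq0 -lt0n; apply/card_gt0P; exists a0.
rewrite (partition_big r predT) //= !card_ffun !natrX.
under eq_bigr => v _.
  rewrite (eq_bigr (fun=> expR (f v))); last by move=> w /eqP <-.
  rewrite sumr_const fiber -[expR _ *+ _]mulr_natl natrX; over.
rewrite -mulr_sumr mulrA; congr (_ * _).
rewrite -{1}(subnK ST) exprD invfM mulrC mulrA divff ?mul1r //.
by rewrite expf_neq0.
Qed.

(** * Counting the translates [Eg] that meet [F] *)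

Section Translates.
Variable G : groupType.
Implicit Types (E F : {fset G}) (g : G).

Definition fset_invg E : {fset G} := [fset (x^-1)%g | x in E]%fset.

Definition translate E g : {fset G} := [fset (x * g)%g | x in E]%fset.

Lemma mem_translate E g x : (x \in translate E g) = ((x * g^-1)%g \in E).
Proof.
apply/imfsetP/idP => [[y yE ->]|xE]; first by rewrite mulgK.
by exists (x * g^-1)%g; rewrite ?mulgVK.
Qed.

Lemma card_translate E g : #|` translate E g| = #|` E|.
Proof. by rewrite card_imfset //; apply: mulIg. Qed.

Lemma fset_mulgP E F x :
  reflect (exists e f, [/\ e \in E, f \in F & x = (e * f)%g])
          (x \in fset_mulg E F).
Proof.
apply: (iffP idP) => [/imfset2P[e eE [f fF ->]]|[e [f [eE fF ->]]]].
  by exists e, f.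
by apply/imfset2P; exists e => //; exists f.
Qed.

Lemma mem_fset_invg E x : (x \in fset_invg E) = ((x^-1)%g \in E).
Proof.
apply/imfsetP/idP => [[y yE ->]|xE]; first by rewrite invgK.
by exists (x^-1)%g; rewrite ?invgK.
Qed.

Lemma card_fset_invg E : #|` fset_invg E| = #|` E|.
Proof. by rewrite card_imfset //; apply: invg_inj. Qed.

Lemma card_fset_mulg E F : (#|` fset_mulg E F| <= #|` E| * #|` F|)%N.
Proof.
pose h (p : E * F) : G := (val p.1 * val p.2)%g.
have -> : fset_mulg E F = [fset h p | p in {: E * F}]%fset.
  apply/fsetP => x; apply/fset_mulgP/imfsetP => [[e [f [eE fF ->]]]|[[e f] _ ->]].
    by exists ([` eE]%fset, [` fF]%fset).
  by exists (val e), (val f); rewrite !fsvalP.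
apply: leq_trans (leq_imfset_card _ _ _) _.
by rewrite !cardfE -card_prod cardE.
Qed.

Definition meeting_translates E F : {fset G} := fset_mulg (fset_invg E) F.

Lemma meeting_translatesP E F g :
  reflect (exists2 f, f \in F & (f * g^-1)%g \in E) (g \in meeting_translates E F).
Proof.
apply: (iffP (fset_mulgP _ _ _)) => [[e [f [+ fF ->]]]|[f fF eE]].
  by rewrite mem_fset_invg => eE; exists f => //; rewrite invgM mulgA mulgV mul1g.
exists (g * f^-1)%g, f; rewrite mulgVK; split => //.
by rewrite mem_fset_invg invgM invgK.
Qed.

(** The translates through [f] are indexed by [E] via [e |-> e^-1 f]. *)
Lemma card_translates_through E F (f : F) :
  #|[set g : meeting_translates E F | (val f * (val g)^-1)%g \in E]%SET| = #|` E|.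
Proof.
have hP (e : E) : ((val e)^-1 * val f)%g \in meeting_translates E F.
  apply/meeting_translatesP; exists (val f); first exact: fsvalP.
  by rewrite invgM mulgA mulgV mul1g invgK fsvalP.
pose h (e : E) : meeting_translates E F := [` hP e]%fset.
have hI : injective h.
  by move=> e e' /(congr1 val) /= /mulIg /invg_inj /val_inj.
rewrite cardfE -(card_imset _ hI); apply: eq_card => g; rewrite inE.
apply/idP/imsetP => [eE|[e _ ->]].
  by exists [` eE]%fset => //; apply: val_inj; rewrite /= invgM invgK mulgVK.
by rewrite /= invgM mulgA mulgV mul1g invgK fsvalP.
Qed.

Lemma sum_translates (V : nmodType) E F (h : G -> V) :
  \sum_(g : meeting_translates E F) \sum_(x <- (translate E (val g) `&` F)%fset) h x =
  (\sum_(x <- F) h x) *+ #|` E|.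
Proof.
pose D := meeting_translates E F.
rewrite (eq_bigr (fun g : D =>
    \sum_(f : F | (val f * (val g)^-1)%g \in E) h (val f))); last first.
  move=> g _; have -> : (translate E (val g) `&` F =
      [fset x in F | (x * (val g)^-1)%g \in E])%fset.
    by apply/fsetP => x; rewrite !inE mem_translate andbC.
  by rewrite big_fset big_seq_fsetE.
rewrite big_seq_fsetE (exchange_big_dep predT) //= -sumrMnl.
apply: eq_bigr => f _; rewrite sumr_const -(card_translates_through E f).
by congr (_ *+ _); apply: eq_card => g; rewrite inE.
Qed.

(** For a fixed [e] in [E], the map [g |-> e g] injects these indices into [F]. *)
Lemma card_translates_inside E F : E != fset0 ->
  (#|[set g : meeting_translates E F | (translate E (val g) `<=` F)%fset]%SET| <=
   #|` F|)%N.
Proof.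
case/fset0Pn => e eE; set S := finset _.
have -> : #|S| = #|` [fset (e * val g)%g | g in S]%fset|.
  by rewrite card_imfset ?cardE //= => g g' /mulgI /val_inj.
apply/fsubset_leq_card/fsubsetP => _ /imfsetP[g + ->].
rewrite inE => /fsubsetP; apply.
by apply/imfsetP; exists e.
Qed.

(** Such a translate contains some [f = e' g] in [F] and some [e g] outside [F]. Then
    [e g = e e'^-1 f] lies in [E E^-1 F] minus [F], and [g] is recovered from this point and [e]. *)
Lemma card_translates_crossing E F :
  (#|[set g : meeting_translates E F | ~~ (translate E (val g) `<=` F)%fset]%SET| <=
   #|` E| * #|` (fset_mulg (fset_mulg E (fset_invg E)) F `\` F)%fset|)%N.
Proof.
set S := finset _.
have -> : #|S| = #|` [fset val g | g in S]%fset|.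
  by rewrite card_imfset ?cardE //; apply: val_inj.
rewrite -(card_fset_invg E); apply: leq_trans (card_fset_mulg _ _).
apply/fsubset_leq_card/fsubsetP => _ /imfsetP[g + ->].
rewrite inE => /fsubsetPn[_ /imfsetP[e /= eE ->] egF].
have /meeting_translatesP[f fF fgE] := fsvalP g.
apply/fset_mulgP; exists (e^-1)%g, (e * val g)%g; rewrite mulKg mem_fset_invg invgK.
split => //; rewrite inE egF; apply/fset_mulgP.
exists (e * (f * (val g)^-1)^-1)%g, f; split => //.
  apply/fset_mulgP; exists e, ((f * (val g)^-1)^-1)%g.
  by rewrite mem_fset_invg invgK.
by rewrite invgM invgK -!mulgA mulVg mulg1.
Qed.

End Translates.

(** * Compactness of the subshift and boundedness of the potential *)

Lemma subshift_on_compact (G : groupType) (A : {fset nat}) :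
  compact (subshift_on A : set (full_shift G)).
Proof.
apply: (@tychonoff G (fun=> nat) (fun=> [set` A])) => g.
by apply: finite_compact; exact: finite_fset.
Qed.

Lemma continuous_bounded_on_subshift (R : realType) (G : groupType)
    (phi : full_shift G -> R) (A : {fset nat}) :
  continuous phi ->
  exists M : R, 0 <= M /\ forall x, subshift_on A x -> `|phi x| <= M.
Proof.
move=> phi_cont.
have /compact_bounded[N [_ NP]] : compact (phi @` subshift_on A).
  apply: continuous_compact; last exact: subshift_on_compact.
  exact: continuous_subspaceT.
(* Every number above [N] is a bound, hence [N + 1]; the maximum makes it nonnegative. *)
exists (Num.max 0 (N + 1)); split => [|x xA]; first by rewrite le_max lexx.
rewrite le_max; apply/orP; right.
by apply: (NP (N + 1)); [rewrite ltrDl | exists x].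
Qed.

(** * Estimates for the normalised log-partition function *)

Section PressureEstimates.
Variables (R : realType) (G : groupType) (phi : full_shift G -> R).
Variables (A : {fset nat}) (a0 : A) (M : R).
Hypothesis phi_le : forall x, subshift_on A x -> `|phi x| <= M.
Implicit Types (E F : {fset G}) (x : full_shift G).

Definition cyl_sup F (w : {ffun F -> A}) : R :=
  sup (birkhoff_sum phi F @`
         (cylinder (fun h => val (w h)) `&` subshift_on A)).

Definition norm_log_partition F : R := logmean (@cyl_sup F).

Lemma shift_act_mem g x : subshift_on A x -> subshift_on A (shift_act g x).
Proof. by move=> xA h; apply: xA. Qed.

Lemma birkhoff_sum_le F x : subshift_on A x ->
  `|birkhoff_sum phi F x| <= M * #|` F|%:R.
Proof.
move=> xA; apply: le_trans (ler_norm_sum _ _ _) _.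
apply: le_trans (ler_sum _ (fun g _ => phi_le (shift_act_mem g xA))) _.
by rewrite big_const_seq count_predT iter_addr_0 mulr_natr.
Qed.

Lemma birkhoff_sum_translate E g x :
  birkhoff_sum phi (translate E g) x = birkhoff_sum phi E (shift_act g x).
Proof.
rewrite /birkhoff_sum big_imfset /=; last by move=> ? ? _ _; exact: mulIg.
by apply: eq_bigr => e _; congr phi; apply/funext => h; rewrite /shift_act mulgA.
Qed.

Lemma cyl_sup_ge F (w : {ffun F -> A}) x :
  (forall g : F, x (val g) = val (w g)) -> subshift_on A x ->
  birkhoff_sum phi F x <= cyl_sup w.
Proof.
move=> xw xA; apply: ub_le_sup; last by exists x.
exists (M * #|` F|%:R) => _ [y [_ yA] <-].
exact: le_trans (ler_norm _) (birkhoff_sum_le F yA).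
Qed.

(** Extending [w] by the letter [a0] gives such a point; hence [cyl_sup] is never the default value
    of an empty supremum. *)
Lemma cyl_nonempty F (w : {ffun F -> A}) :
  exists x, (forall g : F, x (val g) = val (w g)) /\ subshift_on A x.
Proof.
exists (fun g => if insub g is Some g' then val (w g') else val a0).
split=> [g|g]; first by rewrite valK.
by case: insubP => [g' _ _|_]; exact: fsvalP.
Qed.

Lemma cyl_sup_le F (w : {ffun F -> A}) (c : R) :
  (forall x, (forall g : F, x (val g) = val (w g)) -> subshift_on A x ->
     birkhoff_sum phi F x <= c) ->
  cyl_sup w <= c.
Proof.
move=> le_c; have [y [yw yA]] := cyl_nonempty w.
apply: ge_sup; first by exists (birkhoff_sum phi F y), y.
by move=> _ [x [xw xA] <-]; exact: le_c.
Qed.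

Lemma norm_cyl_sup F (w : {ffun F -> A}) : `|cyl_sup w| <= M * #|` F|%:R.
Proof.
have [y [yw yA]] := cyl_nonempty w.
rewrite ler_norml; apply/andP; split.
  apply: le_trans (cyl_sup_ge yw yA).
  by have := birkhoff_sum_le F yA; rewrite ler_norml => /andP[].
apply: cyl_sup_le => x _ xA.
exact: le_trans (ler_norm _) (birkhoff_sum_le F xA).
Qed.

Lemma norm_norm_log_partition F : `|norm_log_partition F| <= M * #|` F|%:R.
Proof.
have w0 : {ffun F -> A} := [ffun=> a0].
have sup_bounds w := norm_cyl_sup (w : {ffun F -> A}).
rewrite ler_norml; apply/andP; split;
  [rewrite -[leLHS](logmean_cst w0)|rewrite -[leRHS](logmean_cst w0)];
  apply: (ler_logmean w0) => w;
  by have := sup_bounds w; rewrite ler_norml => /andP[].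
Qed.

(** Averaging over the [|A|^|F|] configurations only shifts the mean by a constant independent of
    [F], so comparisons of means can be made after normalisation. *)
Lemma mean_log_partitionE F : F != fset0 ->
  mean_log_partition A phi F =
  #|` F|%:R^-1 * norm_log_partition F + ln #|` A|%:R.
Proof.
move=> F0; have cF : (#|` F|%:R : R) != 0 by rewrite pnatr_eq0 cardfs_eq0.
have cA : 0 < (#|` A|%:R : R).
  by rewrite ltr0n cardfs_gt0; apply/fset0Pn; exists (val a0); exact: fsvalP.
rewrite /mean_log_partition /norm_log_partition /logmean card_ffun -!cardfE.
have Z0 : 0 < partition_fun A phi F by apply: (sum_expR_gt0 [ffun=> a0]).
rewrite -/(partition_fun A phi F) lnM ?posrE ?invr_gt0 ?natrX ?exprn_gt0 //.
rewrite lnV ?posrE ?exprn_gt0 // lnXn // -[ln _ *+ _]mulr_natl.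
by rewrite mulrDr mulrN mulKf // addrAC addNr add0r.
Qed.

(** The shift by [g] preserves the subshift and carries the Birkhoff sum over [Eg] to that over [E];
    relabelling [h] as [h g] matches the configurations. *)
Lemma norm_log_partition_translate E g :
  norm_log_partition (translate E g) = norm_log_partition E.
Proof.
have jP (e : E) : (val e * g)%g \in translate E g.
  by rewrite mem_translate mulgK fsvalP.
pose j (e : E) : translate E g := [` jP e]%fset.
have jI : injective j by move=> e e' /(congr1 val) /= /mulIg /val_inj.
rewrite /norm_log_partition -[RHS](logmean_comp_inj a0 _ jI); congr logmean.
apply/funext => w; apply/eqP; rewrite eq_le; apply/andP; split.
  apply: cyl_sup_le => x xw xA; rewrite birkhoff_sum_translate.
  apply: cyl_sup_ge; last exact: shift_act_mem.
  by move=> e; rewrite ffunE -xw.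
apply: cyl_sup_le => y yw yA.
have -> : y = shift_act g (shift_act (g^-1)%g y).
  by apply/funext => h; rewrite /shift_act mulgK.
rewrite -birkhoff_sum_translate; apply: cyl_sup_ge; last exact: shift_act_mem.
move=> h; have hE : (val h * g^-1)%g \in E by rewrite -mem_translate fsvalP.
rewrite /shift_act (yw [` hE]%fset) ffunE; congr (val (w _)).
by apply: val_inj; rewrite /= mulgVK.
Qed.

(* A Shearer-type inequality: every point of [F] lies in exactly [#|` E|] of
   the sets [Eg], so these exactly cover [F] with multiplicity [#|` E|]. *)
Lemma norm_log_partition_shearer E F : E != fset0 ->
  norm_log_partition F <=
  #|` E|%:R^-1 * \sum_(g : meeting_translates E F)
                   norm_log_partition (translate E (val g) `&` F)%fset.
Proof.
move=> E0; have cE : (#|` E|%:R : R) != 0 by rewrite pnatr_eq0 cardfs_eq0.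
pose D := meeting_translates E F.
pose EF (g : D) := (translate E (val g) `&` F)%fset.
have EFsub (g : D) : (EF g `<=` F)%fset by exact: fsubsetIr.
pose J (f : F) := [set g : D | (val f * (val g)^-1)%g \in E]%SET.
(* Read as a function of configurations on all of [F], the supremum on [Eg] cap [F] keeps its
   log-mean and depends only on coordinates in [Eg]. *)
pose v (g : D) (w : {ffun F -> A}) :=
  cyl_sup [ffun h : EF g => w (fincl (EFsub g) h)].
rewrite (eq_bigr (fun g => logmean (v g))); last first.
  move=> g _; apply/esym; apply: (logmean_comp_inj a0 (j := fincl (EFsub g))).
  exact: fincl_inj.
apply: (logmean_finner a0 (J := J)).
- by rewrite cardfs_gt0.
- exact: card_translates_through.
- move=> f g; rewrite inE => fgE w a; rewrite /v; congr cyl_sup.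
  apply/ffunP => h; rewrite !ffunE; case: eqP => // hf; case/negP: fgE.
  by rewrite -hf -mem_translate; have := fsvalP h; rewrite inE => /andP[].
move=> w; apply: cyl_sup_le => x xw xA.
suff -> : birkhoff_sum phi F x = #|` E|%:R^-1 * \sum_g birkhoff_sum phi (EF g) x.
  rewrite ler_wpM2l ?invr_ge0 ?ler0n // ler_sum // => g _.
  by apply: cyl_sup_ge => // h; rewrite ffunE -xw.
rewrite /birkhoff_sum.
rewrite (sum_translates _ _ (fun h => phi (shift_act h x))).
by rewrite -[X in _ = _ * X]mulr_natl mulKf.
Qed.

Lemma mean_norm_log_partition_le E F :
  0 <= M -> E != fset0 -> F != fset0 ->
  #|` F|%:R^-1 * norm_log_partition F <=
  #|` E|%:R^-1 * norm_log_partition E + 2 * M * #|` E|%:R *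
    (#|` (fset_mulg (fset_mulg E (fset_invg E)) F `\` F)%fset|%:R / #|` F|%:R).
Proof.
move=> M0 E0 F0; set s := (#|` (_ `\` F)%fset|%:R : R).
have E_gt0 : 0 < (#|` E|%:R : R) by rewrite ltr0n cardfs_gt0.
have F_gt0 : 0 < (#|` F|%:R : R) by rewrite ltr0n cardfs_gt0.
pose D := meeting_translates E F.
pose EF (g : D) := (translate E (val g) `&` F)%fset.
(* The added term makes [q] nonnegative, so the number of inner translates may be replaced by its
   upper bound [|F|]. It satisfies the Shearer bound with equality, by exact covering. *)
pose q (H : {fset G}) := norm_log_partition H + M * #|` H|%:R.
have q_ge0 H : 0 <= q H.
  by rewrite -lerBlDr sub0r; have := norm_norm_log_partition H;
    rewrite ler_norml => /andP[].
have q_le H : q H <= 2 * M * #|` H|%:R.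
  rewrite -mulrA mulr_natl mulr2n lerD2r.
  exact: le_trans (ler_norm _) (norm_norm_log_partition H).
have sumq : #|` E|%:R * q F <= \sum_g q (EF g).
  rewrite /q big_split /= -mulr_sumr mulrDr lerD //.
    by rewrite -ler_pdivlMl // norm_log_partition_shearer.
  have /= := sum_translates E F (fun=> 1 : R).
  rewrite big_const_seq count_predT iter_addr_0 -mulrnA mulnC natrM => sumEF.
  rewrite mulrCA -sumEF ler_wpM2l // ler_sum // => g _.
  by rewrite big_const_seq count_predT iter_addr_0.
have {}sumq : #|` E|%:R * q F <= #|` F|%:R * q E + #|` E|%:R * s * (2 * M * #|` E|%:R).
  apply: le_trans sumq _; rewrite (bigID (fun g => translate E (val g) `<=` F)%fset) /=.
  apply: lerD.
    rewrite (eq_bigr (fun=> q E)); last first.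
      move=> g /fsetIidPl gF.
      by rewrite /q /EF gF norm_log_partition_translate card_translate.
    rewrite sumr_const -[q E *+ _]mulr_natl ler_wpM2r // ler_nat.
    apply: leq_trans (card_translates_inside F E0).
    by rewrite cardsE.
  apply: (@le_trans _ _ (\sum_(g : D | ~~ (translate E (val g) `<=` F)%fset)
                            (2 * M * #|` E|%:R))).
    apply: ler_sum => g _; apply: le_trans (q_le _) _.
    rewrite ler_wpM2l ?mulr_ge0 // ler_nat -(card_translate E (val g)).
    exact/fsubset_leq_card/fsubsetIl.
  rewrite sumr_const -[X in X <= _]mulr_natl ler_wpM2r ?mulr_ge0 //.
  rewrite -natrM ler_nat; apply: leq_trans (card_translates_crossing E F).
  by rewrite cardsE.
rewrite ler_pdivrMl //.
have -> : norm_log_partition F = q F - M * #|` F|%:R by rewrite /q addrK.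
rewrite lerBlDr -(ler_pM2l E_gt0); apply: le_trans sumq _.
by rewrite le_eqVlt; apply/orP; left; apply/eqP; rewrite /q; field; rewrite !gt_eqF.
Qed.

End PressureEstimates.

(** * Convergence of the means to their infimum *)

Theorem theorem3p1 (R : realType) (G : groupType)
    (countableG : countable [set: G]) (amenableG : amenable G R)
    (phi : full_shift G -> R) (phi_cont : continuous phi)
    (A : {fset nat}) (A_neq0 : A != fset0) :
  exists p : R,
    folner_cvg (mean_log_partition A phi) p /\
    p%:E = ereal_inf [set (mean_log_partition A phi E)%:E |
                        E in [set E : {fset G} | E != fset0]].
Proof.
have [M [M0 phi_le]] := continuous_bounded_on_subshift A phi_cont.
have [a aA] := fset0Pn _ A_neq0; pose a0 : A := [` aA]%fset.
pose mean := mean_log_partition A phi.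
pose S := mean @` [set E : {fset G} | E != fset0].
(* This makes the real [inf] a true infimum, equal to the extended one. *)
have S_has_inf : has_inf S.
  split; first by exists (mean [fset 1%g]%fset), [fset 1%g]%fset => //=;
    apply/fset0Pn; exists 1%g; rewrite inE.
  exists (- M + ln #|` A|%:R) => _ [E /= E0 <-].
  rewrite /mean (mean_log_partitionE _ a0 E0) lerD2r ler_pdivlMl; last first.
    by rewrite ltr0n cardfs_gt0.
  rewrite mulrN mulrC.
  by have := norm_norm_log_partition a0 phi_le E; rewrite ler_norml => /andP[].
exists (inf S); split; last first.
  rewrite -ereal_inf_EFin; [|by case: S_has_inf|by case: S_has_inf].
  by congr ereal_inf; rewrite /S image_comp.
move=> eps eps0.
have [_ [E /= E0 <-] meanE] := inf_adherent (divr_gt0 eps0 (ltr0n _ 2)) S_has_inf.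
(* The coefficient of the boundary term, plus 1 so that division by [c] is legitimate even when
   [M = 0]. *)
pose c := 2 * M * #|` E|%:R + 1.
have c_gt0 : 0 < c by rewrite ltr_wpDl // !mulr_ge0.
exists (fset_mulg E (fset_invg E)), (eps / 2 / c); split.
- have [e eE] := fset0Pn _ E0; apply/fset0Pn; exists (e * e^-1)%g.
  by apply/fset_mulgP; exists e, (e^-1)%g; rewrite mem_fset_invg invgK.
- by rewrite !divr_gt0.
move=> F F0 Finv.
have F_gt0 : 0 < (#|` F|%:R : R) by rewrite ltr0n cardfs_gt0.
have inf_le : inf S <= mean F by apply: ge_inf; [case: S_has_inf|exists F].
rewrite ger0_norm ?subr_ge0 // ltrBlDl -/(mean F).
(* The other [eps / 2], and the strictness, come from [meanE]. *)
suff : mean F <= mean E + eps / 2 by lra.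
rewrite /mean !(mean_log_partitionE _ a0) // addrAC lerD2r.
apply: le_trans (mean_norm_log_partition_le a0 phi_le M0 E0 F0) _.
rewrite lerD2l; set t := _ / _.
have t_ge0 : 0 <= t by rewrite divr_ge0.
apply: (@le_trans _ _ (c * t)); first by rewrite ler_wpM2r // lerDl.
rewrite -ler_pdivlMl // mulrC ler_pdivrMr //.
(* The boundary [KF] minus [F] is one half of the symmetric difference that invariance controls. *)
apply/ltW/(le_lt_trans _ Finv); rewrite ler_nat.
exact/fsubset_leq_card/fsubsetUl.
Qed.
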